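(* Let $(\Omega,\mathcal{A},\mu,T)$ be a measure-preserving dynamical system and let $\mathbf{X}=(X_i)_{i\in\mathbb{N}}$ be a sequence of observables such that $$\sigma\big((\mathbf{X}\circ T^{\circ t})_{t\in\mathbb{N}_0}\big)\overset{\mu}{\supset}\mathcal{A}.$$ Assume that at least one of the following holds: (i) $T$ is ergodic with respect to $\mu$, i.e. $\mu(A)\in\{0,1\}$ for all $A\in\mathcal{A}$ with $T^{-1}(A)=A$; (ii) $\Omega$ can be embedded into some compact metrizable space so that $\mathcal{A}=\mathcal{B}(\Omega)$. Then $$h_\mu^{\mathrm{KS}}(T)=\lim_{d,n\to\infty}h_\mu\big(T,\mathcal{P}_d^{(X_i)_{i=1}^n,T}\big)=\sup_{d,n\in\mathbb{N}}h_\mu\big(T,\mathcal{P}_d^{(X_i)_{i=1}^n,T}\big).$$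
   Context: A measure-preserving dynamical system $(\Omega,\mathcal{A},\mu,T)$ consists of a non-empty set $\Omega$, a $\sigma$-algebra $\mathcal{A}$ on $\Omega$, a probability measure $\mu:\mathcal{A}\to[0,1]$ and an $\mathcal{A}$-$\mathcal{A}$-measurable map $T:\Omega\to\Omega$ with $\mu(T^{-1}(A))=\mu(A)$ for all $A\in\mathcal{A}$. $T^{\circ t}$ denotes the $t$-th iterate of $T$. $\mathcal{B}(\Omega)$ is the Borel $\sigma$-algebra of a topological space $\Omega$ (in (ii), of $\Omega$ with the topology inherited from the compact metrizable space). An observable is an $\mathbb{R}$-valued random variable on $(\Omega,\mathcal{A},\mu)$. $\sigma((\mathbf{X}\circ T^{\circ t})_{t\in\mathbb{N}_0})$ is the $\sigma$-algebra generated by all $X_i\circ T^{\circ t}$, $i\in\mathbb{N}$, $t\in\mathbb{N}_0$. For families $\mathcal{F},\mathcal{G}$ of measurable sets, $\mathcal{F}\overset{\mu}{\supset}\mathcal{G}$ means that for each $G\in\mathcal{G}$ there exists $F\in\mathcal{F}$ with $\mu(F\,\Delta\,G)=0$. Entropy: for a finite partition $\mathcal{C}=\{C_1,\ldots,C_q\}\subset\mathcal{A}$ of $\Omega$ (into non-empty sets), $H_\mu(\mathcal{C})=-\sum_{l=1}^q\mu(C_l)\ln\mu(C_l)$ with $0\ln 0:=0$. For a finite partition $\mathcal{P}=\{P_1,\ldots,P_q\}\subset\mathcal{A}$, $\mathcal{P}_t$ is the partition of $\Omega$ consisting of the non-empty sets $\{\omega\mid\omega\in P_{a_1},T(\omega)\in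 P_{a_2},\ldots,T^{\circ t-1}(\omega)\in P_{a_t}\}$, $a_1,\ldots,a_t\in\{1,\ldots,q\}$. The entropy rate is $h_\mu(T,\mathcal{P})=\lim_{t\to\infty}\frac1t H_\mu(\mathcal{P}_t)$, and the Kolmogorov-Sinai entropy is $h_\mu^{\mathrm{KS}}(T)=\sup_{\mathcal{P}}h_\mu(T,\mathcal{P})$, the supremum over all finite partitions $\mathcal{P}\subset\mathcal{A}$ of $\Omega$. Ordinal partitions: for an observable $X$ and $s,t\in\mathbb{N}_0$ with $s<t$, $$\mathcal{P}^{X,T}_{s,t}=\{\{\omega\mid X(T^{\circ s}(\omega))<X(T^{\circ t}(\omega))\},\{\omega\mid X(T^{\circ s}(\omega))\ge X(T^{\circ t}(\omega))\}\}$$ (with an empty set omitted), and for $d,n\in\mathbb{N}$, $$\mathcal{P}_d^{(X_i)_{i=1}^n,T}=\bigvee_{i=1}^n\ \bigvee_{0\le s<t\le d}\mathcal{P}^{X_i,T}_{s,t},$$ where $\bigvee$ denotes the join, i.e. the coarsest partition refining all the given partitions. *)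

(* Defs.v *)
From HB Require Import structures.
From mathcomp Require Import all_boot all_order all_algebra.
From mathcomp Require Import all_classical all_reals all_analysis.
Import Order.TTheory GRing.Theory Num.Theory.
Import numFieldNormedType.Exports.

Set Implicit Arguments.
Unset Strict Implicit.
Unset Printing Implicit Defensive.

Local Open Scope classical_set_scope.
Local Open Scope ring_scope.

(* A partition of a type is the (unindexed) set of its blocks. *)
Section partitions.
Context {T : Type}.
Implicit Types P Q : set (set T).

Definition set_partition P := partition P id [set: T].

Definition refines Q P := forall B, Q B -> exists2 C, P C & B `<=` C.

(* Explicit form of the join; lemmas join_partition, join_refines and
   join_coarsest show that it is the coarsest partition refining all P i. *)
Definition join {I : Type} (D : set I) (P : I -> set (set T)) : set (set T) :=
  [set B | B !=set0 /\ exists C : I -> set T,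
     (forall i, D i -> P i (C i)) /\ B = \bigcap_(i in D) C i].

Lemma set_partition_eq P B C x :
  set_partition P -> P B -> P C -> B x -> C x -> B = C.
Proof. by case=> _ tP _ PB PC Bx Cx; apply: (tP B C PB PC); exists x. Qed.

Lemma set_partition_cover P x : set_partition P -> exists2 B, P B & B x.
Proof.
case=> + _ _; move=> cP.
by have : [set: T] x by []; rewrite -cP => -[B PB Bx]; exists B.
Qed.

Section join_theory.
Context {I : Type} (D : set I) (P : I -> set (set T)).
Hypothesis partP : forall i, D i -> set_partition (P i).

Lemma join_block x : exists2 C : I -> set T,
  (forall i, D i -> P i (C i)) & (\bigcap_(i in D) C i) x.
Proof.
have /choice[C CP] : forall i, exists B : set T, D i -> P i B /\ B x.
  move=> i; have [Di|nDi] := pselect (D i); last by exists set0.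
  by have [B PB Bx] := set_partition_cover x (partP Di); exists B.
by exists C => [i /CP[]|i /CP[]].
Qed.

Lemma join_partition : set_partition (join D P).
Proof.
split.
- apply/seteqP; split=> // x _; have [C CP Cx] := join_block x.
  by exists (\bigcap_(i in D) C i) => //; split; [exists x|exists C].
- move=> B1 B2 [_ [C1 [C1P ->]]] [_ [C2 [C2P ->]]] [x [/= x1 x2]].
  apply: eq_bigcapr => i Di.
  by apply: (set_partition_eq (partP Di) (C1P i Di) (C2P i Di) (x1 i Di) (x2 i Di)).
- by move=> B [].
Qed.

Lemma join_refines i : D i -> refines (join D P) (P i).
Proof.
by move=> Di B [_ [C [CP ->]]]; exists (C i); [exact: CP|exact: bigcap_inf].
Qed.

Lemma join_coarsest Q : set_partition Q ->
  (forall i, D i -> refines Q (P i)) -> refines Q (join D P).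
Proof.
move=> [_ _ Q0] QP B QB; have [x Bx] := Q0 _ QB.
have [C CP Cx] := join_block x; exists (\bigcap_(i in D) C i).
  by split; [exists x|exists C].
move=> y By i Di; have [E PE BE] := QP i Di _ QB.
by rewrite (set_partition_eq (partP Di) (CP i Di) PE (Cx i Di) (BE _ Bx)); exact: BE.
Qed.

End join_theory.
End partitions.

Section dynamics.
Context {d : measure_display} {Omega : measurableType d} {R : realType}.
Variables (mu : probability Omega R) (T : Omega -> Omega).

Definition measure_preserving :=
  measurable_fun [set: Omega] T /\
  forall A : set Omega, measurable A -> mu (T @^-1` A) = mu A.

Definition ergodic :=
  forall A : set Omega, measurable A -> T @^-1` A = A ->
    mu A = 0%E \/ mu A = 1%E.

Definition mu_supset (F G : set (set Omega)) :=
  forall A, G A -> exists2 B, F B & mu (B `+` A) = 0%E.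

Definition finite_measurable_partition (P : set (set Omega)) :=
  [/\ finite_set P, P `<=` measurable & set_partition P].

(* The library's ln satisfies ln 0 = 0, and 0 * ln 0 = 0 in any case. *)
Definition partition_entropy (P : set (set Omega)) : R :=
  - \sum_(C \in P) fine (mu C) * ln (fine (mu C)).

Definition itinerary_partition (P : set (set Omega)) (t : nat) :
    set (set Omega) :=
  [set B | B !=set0 /\ exists a : 'I_t -> set Omega,
     (forall k, P (a k)) /\ B = [set w | forall k : 'I_t, a k (iter k T w)]].

Definition entropy_rate (P : set (set Omega)) : R :=
  limn (fun t : nat => t%:R^-1 * partition_entropy (itinerary_partition P t)).

Definition KS_entropy : \bar R :=
  ereal_sup [set (entropy_rate P)%:E | P in finite_measurable_partition].

Definition ordinal_partition2 (X : Omega -> R) (s t : nat) : set (set Omega) :=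
  [set B | B !=set0 /\
     (B = [set w | X (iter s T w) < X (iter t T w)] \/
      B = [set w | X (iter s T w) >= X (iter t T w)])].

(* The sequence X is indexed from 0: the observables entering here are
   X 0, ..., X n.-1. *)
Definition ordinal_partition (X : nat -> Omega -> R) (dd n : nat) :
    set (set Omega) :=
  join [set i | (i < n)%N] (fun i =>
    join [set st : nat * nat | (st.1 < st.2 <= dd)%N] (fun st =>
      ordinal_partition2 (X i) st.1 st.2)).

Definition sigma_orbit (X : nat -> Omega -> R) : set (set Omega) :=
  <<s \bigcup_i \bigcup_t
        preimage_set_system [set: Omega] (X i \o iter t T) measurable >>.

(* The topology on Omega inherited from a compact metric space K through an
   injection e is initial_topology e. *)
Definition borel_in_compact_metrizable : Prop :=
  exists (K : metricType R) (e : Omega -> K),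
    [/\ compact [set: K], injective e &
        @measurable d Omega = <<s @open (initial_topology e) >>].

End dynamics.
Arguments borel_in_compact_metrizable {d} Omega R.

(* Main.v *)
Require Import Defs.
From HB Require Import structures.
From mathcomp Require Import all_boot all_order all_algebra.
From mathcomp Require Import all_classical all_reals all_analysis.
From mathcomp Require Import measurable_realfun lra.
Import Order.TTheory GRing.Theory Num.Theory.
Import numFieldNormedType.Exports.

Set Implicit Arguments.
Unset Strict Implicit.
Unset Printing Implicit Defensive.

Local Open Scope classical_set_scope.
Local Open Scope ring_scope.

(** Finite partitions are handled as the fibres of finite-valued maps f, and
    H(f | g) denotes conditional entropy.  The entropy rate of every finite
    partition has to be bounded, up to an arbitrarily small error, by that of
    an ordinal partition O.  Two approximations do this.

    Since the events a <= X_i o T^t generate the sigma-algebra modulo null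
    sets, a finite partition C has small conditional entropy given the joint
    outcome A of finitely many of them: the events that are approximable in
    this sense form a sigma-algebra (entropy_approximable_sigma_algebra).

    The outcome A is in turn almost determined by the ordinal pattern and by
    the future values of A.  Indeed, if a <= Y (T^r w) <= Y w for some r >= 1,
    then a <= Y w: the second inequality is ordinal information, the first one
    concerns A at the later time r.  Conversely almost every w with a <= Y w
    has such an r (strict_rise_null): otherwise the values of Y would strictly
    increase along all returns of w to a fixed set, so that w would not return
    to the part of this set where Y stays below some rational number,
    against Poincare recurrence.  Hence H(A | O, A o T, ..., A o T^m) is small
    when m and the length of the ordinal patterns are large.

    The chain rule, read backwards in time along an orbit, converts smallness
    of H(A | O, A o T, ..., A o T^m) into the bound
      h(A) <= h(O) + H(A | O, A o T, ..., A o T^m)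
    for entropy rates (entropy_rate_le); the case m = 0 compares C with A.
    Thus the entropy rates of ordinal partitions come arbitrarily close to the
    Kolmogorov-Sinai entropy from below, and since they increase with the
    pattern length and with the number of observables, their supremum is also
    their limit. *)

(** * Kernels and fibres *)

Definition coarser {O J J' : Type} (f : O -> J) (g : O -> J') :=
  forall x y, g x = g y -> f x = f y.

Definition same_kernel {O J J' : Type} (f : O -> J) (g : O -> J') :=
  forall x y, f x = f y <-> g x = g y.

(** Entropies depend on f only through this partition, which makes all codings
    of the same information interchangeable (eq_entropy below). *)
Definition blocks {O J : Type} (f : O -> J) : set (set O) :=
  [set f @^-1` [set f x] | x in [set: O]].

Lemma eq_blocks {O J J' : Type} (f : O -> J) (g : O -> J') :
  same_kernel f g -> blocks f = blocks g.
Proof.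
move=> fg; have e x : f @^-1` [set f x] = g @^-1` [set g x].
  by apply/seteqP; split=> y /= /fg.
by apply/seteqP; split=> _ [x _ <-]; exists x => //; rewrite e.
Qed.

Lemma sum_pair {V : nmodType} {I J : finType} (F : I * J -> V) :
  \sum_p F p = \sum_i \sum_j F (i, j).
Proof.
by rewrite pair_bigA; apply: eq_bigr => -[].
Qed.

(** * Entropy of finite-valued maps *)

Section entropy.
Context {d : measure_display} {Omega : measurableType d} {R : realType}.
Context (mu : probability Omega R).

Definition measurable_fibres {I : finType} (f : Omega -> I) :=
  forall i, measurable (f @^-1` [set i]).

Definition law {I : finType} (f : Omega -> I) (i : I) : R :=
  fine (mu (f @^-1` [set i])).

Definition neg_xlnx (p : R) : R := - (p * ln p).

Definition entropy {I : finType} (f : Omega -> I) : R :=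
  \sum_i neg_xlnx (law f i).

Definition cond_entropy {I J : finType} (f : Omega -> I) (g : Omega -> J) : R :=
  entropy (fun w => (f w, g w)) - entropy g.

Lemma law_ge0 {I : finType} (f : Omega -> I) i : 0 <= law f i.
Proof. exact: fine_ge0. Qed.

Lemma measurable_fibres_pair {I J : finType} (f : Omega -> I) (g : Omega -> J) :
  measurable_fibres f -> measurable_fibres g ->
  measurable_fibres (fun w => (f w, g w)).
Proof.
move=> mf mg [i j].
rewrite (_ : _ @^-1` _ = (f @^-1` [set i]) `&` (g @^-1` [set j])).
  exact: measurableI.
by apply/seteqP; split=> w /= [-> ->].
Qed.

Lemma measurable_fibres_pred {I : finType} (f : Omega -> I) (D : set I) :
  measurable_fibres f -> measurable (f @^-1` D).
Proof.
move=> mf; rewrite (_ : _ @^-1` _ = \bigcup_(i in D) f @^-1` [set i]).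
  by apply: fin_bigcup_measurable => //; exact: finite_finset.
by apply/seteqP; split=> [w fw|w [i Di /= ->]//]; exists (f w).
Qed.

Lemma law_marginal {I J : finType} (f : Omega -> I) (g : Omega -> J) j :
  measurable_fibres f -> measurable_fibres g ->
  \sum_i law (fun w => (f w, g w)) (i, j) = law g j.
Proof.
move=> mf mg.
have mfg := measurable_fibres_pair mf mg.
rewrite /law sum_fine; last by move=> i _; exact: fin_num_measure.
congr fine.
have -> : g @^-1` [set j] = \bigcup_(i in [set: I])
    (fun w => (f w, g w)) @^-1` [set (i, j)].
  by apply/seteqP; split=> [w /= <-|w [i _ /= [_ ->]]//]; exists (f w).
rewrite measure_fin_bigcup//; [|exact: finite_finset|]; last first.
  by move=> i k _ _ [w [/= [-> _] [->]]].
rewrite (fsbig_fwiden (enum I)) ?enum_uniq// ?big_enum//=.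
  by move=> i _ /=; rewrite mem_enum.
by move=> i [_] /=; case.
Qed.

(** Empty fibres are not blocks, but they contribute 0 ln 0 = 0. *)
Lemma partition_entropy_blocks {I : finType} (f : Omega -> I) :
  partition_entropy mu (blocks f) = entropy f.
Proof.
have -> : blocks f = (fun i => f @^-1` [set i]) @` (range f).
  apply/seteqP; split=> [_ [x _ <-]|_ [_ [x _ <-] <-]].
    by exists (f x) => //; exists x.
  by exists x.
rewrite /partition_entropy fsbig_image; last first.
  move=> i j /set_mem[x _ <-] _ e.
  by have : (f @^-1` [set f x]) x by []; rewrite e.
rewrite (fsbig_fwiden (enum I)) ?enum_uniq//.
- by rewrite big_enum/= -sumrN.
- by move=> i _ /=; rewrite mem_enum.
- move=> i [_ /= nfi]; rewrite (_ : _ @^-1` _ = set0) ?measure0 ?mul0r//.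
  by apply/seteqP; split=> // w /= fw; apply: nfi; exists w.
Qed.

Lemma eq_entropy {I J : finType} (f : Omega -> I) (g : Omega -> J) :
  same_kernel f g -> entropy f = entropy g.
Proof. by move=> /eq_blocks e; rewrite -!partition_entropy_blocks e. Qed.

Lemma neg_xlnx_ge0 p : p <= 1 -> 0 <= neg_xlnx p.
Proof.
move=> p1; rewrite /neg_xlnx oppr_ge0; have [p0|p0] := ltP 0 p.
  by rewrite pmulr_rle0// ln_le0.
by rewrite (ln0 p0) mulr0.
Qed.

Lemma law_le1 {I : finType} (f : Omega -> I) i : measurable_fibres f ->
  law f i <= 1.
Proof.
move=> mf; rewrite -lee_fin fineK ?fin_num_measure//.
exact: probability_le1.
Qed.

Lemma entropy_ge0 {I : finType} (f : Omega -> I) :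
  measurable_fibres f -> 0 <= entropy f.
Proof. by move=> mf; apply: sumr_ge0 => i _; exact/neg_xlnx_ge0/law_le1. Qed.

Lemma neg_xlnx_le (p q : R) : 0 <= p -> p <= q -> - (p * ln q) <= neg_xlnx p.
Proof.
rewrite le_eqVlt => /predU1P[<-|p0] pq; first by rewrite /neg_xlnx !mul0r.
by rewrite lerN2 ler_pM2l// ler_ln// posrE// (lt_le_trans p0).
Qed.

(** Each joint probability is at most the marginal one and ln is increasing. *)
Lemma cond_entropy_ge0 {I J : finType} (f : Omega -> I) (g : Omega -> J) :
  measurable_fibres f -> measurable_fibres g -> 0 <= cond_entropy f g.
Proof.
move=> mf mg; rewrite subr_ge0 /entropy.
rewrite sum_pair exchange_big/=; apply: ler_sum => j _.
rewrite {1}/neg_xlnx -{1}(law_marginal j mf mg) mulr_suml -sumrN.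
apply: ler_sum => i _; apply: neg_xlnx_le; first exact: law_ge0.
rewrite -(law_marginal j mf mg) (bigD1 i)//= lerDl.
by apply: sumr_ge0 => k _; exact: law_ge0.
Qed.

(** A coarser map adds nothing to a finer one, so that entropy f is at most
    the joint entropy, which is entropy g. *)
Lemma le_entropy {I J : finType} (f : Omega -> I) (g : Omega -> J) :
  measurable_fibres f -> measurable_fibres g ->
  coarser f g -> entropy f <= entropy g.
Proof.
move=> mf mg fg; have := cond_entropy_ge0 mg mf; rewrite subr_ge0.
rewrite (@eq_entropy _ _ (fun w => (g w, f w)) g)// => x y.
by split=> [[]//|e]; rewrite e (fg _ _ e).
Qed.

(** The inequality ln x <= x - 1 at x = q / p; the sum of these terms over two
    probability vectors is Gibbs' inequality. *)
Lemma gibbs_term (p q : R) : 0 <= p -> 0 <= q -> (0 < p -> 0 < q) ->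
  p * ln q - p * ln p <= q - p.
Proof.
rewrite le_eqVlt => /predU1P[<-|p0] q0; first by rewrite !mul0r !subr0.
move=> /(_ p0) {}q0.
rewrite -mulrBr -ln_div//.
have /(ler_wpM2l (ltW p0)) : ln (q / p) <= q / p - 1.
  have := @le_ln1Dx R (q / p - 1); rewrite addrCA subrr addr0; apply.
  by rewrite ltrBrDl subrr divr_gt0.
by rewrite mulrBr mulr1 mulrCA divff ?gt_eqF// mulr1.
Qed.

(** Gibbs' inequality for the joint law of f, g, h against the law q that has
    the same marginals on (f, g) and on (g, h) but makes f and h independent
    given g. *)
Lemma strong_subadditivity {I J K : finType} (f : Omega -> I) (g : Omega -> J)
    (h : Omega -> K) :
  measurable_fibres f -> measurable_fibres g -> measurable_fibres h ->
  cond_entropy f (fun w => (g w, h w)) <= cond_entropy f g.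
Proof.
move=> mf mg mh.
have mfg := measurable_fibres_pair mf mg.
have mgh := measurable_fibres_pair mg mh.
pose p i j k := law (fun w => ((f w, g w), h w)) ((i, j), k).
have pE i j k : p i j k = law (fun w => (f w, (g w, h w))) (i, (j, k)).
  by congr (fine (mu _)); apply/seteqP; split=> w /= [-> -> ->].
have p0 i j k : 0 <= p i j k by exact: law_ge0.
pose pfg i j := law (fun w => (f w, g w)) (i, j).
pose pgh j k := law (fun w => (g w, h w)) (j, k).
have fgE i j : \sum_k p i j k = pfg i j.
  rewrite /pfg -(law_marginal (i, j) mh mfg); apply: eq_bigr => k _.
  by congr (fine (mu _)); apply/seteqP; split=> w /= [-> -> ->].
have ghE j k : \sum_i p i j k = pgh j k.
  by rewrite /pgh -(law_marginal (j, k) mf mgh); apply: eq_bigr => i _.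
have gE1 j : \sum_i pfg i j = law g j by exact: law_marginal.
have gE2 j : \sum_k pgh j k = law g j.
  rewrite -(law_marginal j mh mg); apply: eq_bigr => k _.
  by congr (fine (mu _)); apply/seteqP; split=> w /= [-> ->].
pose q i j k := pfg i j * pgh j k / law g j.
have Efgh : entropy (fun w => (f w, (g w, h w))) =
    - \sum_j \sum_i \sum_k p i j k * ln (p i j k).
  rewrite /entropy /neg_xlnx sumrN; congr (- _).
  rewrite exchange_big/= sum_pair; apply: eq_bigr => i _; rewrite sum_pair.
  by apply: eq_bigr => j _; apply: eq_bigr => k _; rewrite pE.
have Efg : entropy (fun w => (f w, g w)) =
    - \sum_j \sum_i \sum_k p i j k * ln (pfg i j).
  rewrite /entropy /neg_xlnx sumrN; congr (- _).
  rewrite exchange_big/= sum_pair.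
  by apply: eq_bigr => i _; apply: eq_bigr => j _; rewrite -mulr_suml fgE.
have Egh : entropy (fun w => (g w, h w)) =
    - \sum_j \sum_i \sum_k p i j k * ln (pgh j k).
  rewrite /entropy /neg_xlnx sumrN; congr (- _).
  rewrite sum_pair; apply: eq_bigr => j _; rewrite exchange_big/=.
  by apply: eq_bigr => k _; rewrite -mulr_suml ghE.
have Eg : entropy g = - \sum_j \sum_i \sum_k p i j k * ln (law g j).
  rewrite /entropy /neg_xlnx sumrN; congr (- _); apply: eq_bigr => j _.
  rewrite -{1}gE1 mulr_suml; apply: eq_bigr => i _.
  by rewrite -mulr_suml fgE.
have term i j k : p i j k * ln (pfg i j) + p i j k * ln (pgh j k)
    - p i j k * ln (law g j) - p i j k * ln (p i j k) <= q i j k - p i j k.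
  have le1 : p i j k <= pfg i j.
    by rewrite -fgE (bigD1 k)//= lerDl sumr_ge0.
  have le2 : p i j k <= pgh j k.
    by rewrite -ghE (bigD1 i)//= lerDl sumr_ge0.
  have le3 : pfg i j <= law g j.
    by rewrite -gE1 (bigD1 i)//= lerDl sumr_ge0// => *; exact: law_ge0.
  have [P0|P0] := ltP 0 (p i j k); last first.
    have -> : p i j k = 0 by apply/eqP; rewrite eq_le P0 p0.
    by rewrite !mul0r !subr0 addr0 !mulr_ge0 ?invr_ge0 ?law_ge0.
  have P1 := lt_le_trans P0 le1; have P2 := lt_le_trans P0 le2.
  have P3 := lt_le_trans P1 le3.
  have q0 : 0 < q i j k by rewrite divr_gt0 ?mulr_gt0.
  have := @gibbs_term (p i j k) (q i j k) (ltW P0) (ltW q0) (fun=> q0).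
  by rewrite /q ln_div ?posrE ?mulr_gt0// lnM ?posrE// mulrBr mulrDr.
have qE j : \sum_i \sum_k q i j k = \sum_i \sum_k p i j k.
  under eq_bigr do rewrite -mulr_suml -mulr_sumr gE2.
  rewrite -mulr_suml -mulr_suml gE1; under [RHS]eq_bigr do rewrite fgE.
  rewrite gE1; have [->|n0] := eqVneq (law g j) 0; first by rewrite !mul0r.
  by rewrite mulfK.
have : \sum_j \sum_i \sum_k (p i j k * ln (pfg i j) + p i j k * ln (pgh j k)
    - p i j k * ln (law g j) - p i j k * ln (p i j k)) <= 0.
  apply: (@le_trans _ _ (\sum_j \sum_i \sum_k (q i j k - p i j k))).
    by do 3 apply: ler_sum => ? _; exact: term.
  rewrite big1// => j _.
  by under eq_bigr do rewrite big_split/= sumrN; rewrite big_split/= sumrN qE subrr.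
under eq_bigr => j _.
  under eq_bigr do rewrite !big_split/= !sumrN.
  rewrite !big_split/= !sumrN; over.
rewrite !big_split/= !sumrN /cond_entropy Efgh Efg Egh Eg; lra.
Qed.

End entropy.

(** Indexing by seq_sub keeps the codomain a finite type, so that entropies of
    finite subfamilies of an infinite family make sense. *)
Definition joint {O : Type} {U : choiceType} {J : Type} (F : U -> O -> J)
    (s : seq U) (w : O) : {ffun seq_sub s -> J} :=
  [ffun u => F (val u) w].

Lemma joint_eqP {O : Type} {U : choiceType} {J : Type} (F : U -> O -> J) s x y :
  joint F s x = joint F s y <-> {in s, forall u, F u x = F u y}.
Proof.
split=> [e u us|e]; last by apply/ffunP => u; rewrite !ffunE e// (valP u).
by move/ffunP: e => /(_ (SeqSub us)); rewrite !ffunE.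
Qed.

Lemma coarser_joint {O : Type} {U : choiceType} {J J' : Type}
    (F : U -> O -> J) s (g : O -> J') :
  {in s, forall u, coarser (F u) g} -> coarser (joint F s) g.
Proof. by move=> Fg x y e; apply/joint_eqP => u us; exact: Fg e. Qed.

Lemma joint_coarser {O : Type} {U : choiceType} {J : Type} (F : U -> O -> J) s u :
  u \in s -> coarser (F u) (joint F s).
Proof. by move=> us x y /joint_eqP; exact. Qed.

Lemma sub_joint {O : Type} {U : choiceType} {J : Type} (F : U -> O -> J) s s' :
  {subset s <= s'} -> coarser (joint F s) (joint F s').
Proof. by move=> ss'; apply: coarser_joint => u /ss'; exact: joint_coarser. Qed.

(** * Calculus of conditional entropy *)
Section conditional_entropy.
Context {d : measure_display} {Omega : measurableType d} {R : realType}.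
Context (mu : probability Omega R).

Lemma measurable_fibres_joint {U : choiceType} {J : finType}
    (F : U -> Omega -> J) (s : seq U) :
  {in s, forall u, measurable_fibres (F u)} -> measurable_fibres (joint F s).
Proof.
move=> mF v; rewrite (_ : _ @^-1` _ =
    \bigcap_(u in [set: seq_sub s]) F (val u) @^-1` [set v u]).
  apply: fin_bigcap_measurable; first exact: finite_finset.
  by move=> u _; apply: mF; exact: valP.
apply/seteqP; split=> [w /= <- u _/=|w /= e]; first by rewrite ffunE.
by apply/ffunP => u; rewrite ffunE; exact: e.
Qed.

Lemma entropy_cst : entropy mu (fun=> tt) = 0.
Proof.
rewrite /entropy (big_pred1 tt); last by case.
rewrite /neg_xlnx /law.
rewrite (_ : _ @^-1` _ = setT); last by apply/seteqP.
by rewrite probability_setT/= ln1 mulr0 oppr0.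
Qed.

Section finite_variables.
Context {I J K : finType}.
Implicit Types (f : Omega -> I) (g : Omega -> J) (h : Omega -> K).

Lemma cond_entropy_coarser f g : coarser f g -> cond_entropy mu f g = 0.
Proof.
move=> fg; apply/eqP; rewrite subr_eq0; apply/eqP/eq_entropy => x y.
by split=> [[]//|e]; rewrite e (fg _ _ e).
Qed.

Lemma le_cond_entropyl f g h :
  measurable_fibres f -> measurable_fibres g -> measurable_fibres h ->
  coarser f (fun w => (h w, g w)) -> cond_entropy mu f g <= cond_entropy mu h g.
Proof.
move=> mf mg mh fhg; rewrite lerD2r; apply: le_entropy.
- exact: measurable_fibres_pair.
- exact: measurable_fibres_pair.
- by move=> x y /[dup] /fhg -> [_ ->].
Qed.

Lemma le_cond_entropyr f g h :
  measurable_fibres f -> measurable_fibres g -> measurable_fibres h ->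
  coarser g h -> cond_entropy mu f h <= cond_entropy mu f g.
Proof.
move=> mf mg mh gh; apply: le_trans (strong_subadditivity mu mf mg mh).
rewrite /cond_entropy (@eq_entropy _ _ _ _ _ _ h (fun w => (g w, h w))); last first.
  by move=> x y; split=> [e|[]//]; rewrite e (gh _ _ e).
rewrite (@eq_entropy _ _ _ _ _ _ (fun w => (f w, h w)) (fun w => (f w, (g w, h w))))//.
by move=> x y; split=> [[-> e]|[-> _ ->]//]; rewrite e (gh _ _ e).
Qed.

Lemma cond_entropy_chain f g h :
  cond_entropy mu (fun w => (f w, g w)) h =
  cond_entropy mu f (fun w => (g w, h w)) + cond_entropy mu g h.
Proof.
rewrite /cond_entropy addrA subrK; congr (_ - _); apply: eq_entropy => x y.
by split=> [[-> -> ->]|[-> -> ->]].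
Qed.

Lemma cond_entropy_trans f g h :
  measurable_fibres f -> measurable_fibres g -> measurable_fibres h ->
  cond_entropy mu f h <= cond_entropy mu f g + cond_entropy mu g h.
Proof.
move=> mf mg mh; have mgh := measurable_fibres_pair mg mh.
have mfg := measurable_fibres_pair mf mg.
have mhg := measurable_fibres_pair mh mg.
apply: (@le_trans _ _ (cond_entropy mu (fun w => (f w, g w)) h)).
  rewrite lerD2r; apply: le_entropy; try exact: measurable_fibres_pair.
  by move=> x y [-> _ ->].
by rewrite cond_entropy_chain lerD2r strong_subadditivity.
Qed.

Lemma cond_entropy_pair_le f g h :
  measurable_fibres f -> measurable_fibres g -> measurable_fibres h ->
  cond_entropy mu (fun w => (f w, g w)) h <=
  cond_entropy mu f h + cond_entropy mu g h.
Proof.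
move=> mf mg mh; have mgh := measurable_fibres_pair mg mh.
rewrite cond_entropy_chain lerD2r; apply: le_trans (strong_subadditivity mu mf mh mg).
rewrite /cond_entropy (@eq_entropy _ _ _ _ _ _ (fun w => (g w, h w)) (fun w => (h w, g w))).
  rewrite lerD2r (@eq_entropy _ _ _ _ _ _ (fun w => (f w, (g w, h w)))
    (fun w => (f w, (h w, g w))))// => x y.
  by split=> -[-> -> ->].
by move=> x y; split=> -[-> ->].
Qed.

End finite_variables.

Lemma cond_entropy_le {I J : finType} (f : Omega -> I) (g : Omega -> J) :
  measurable_fibres f -> measurable_fibres g ->
  cond_entropy mu f g <= entropy mu f.
Proof.
move=> mf mg; have mt : measurable_fibres (fun _ : Omega => tt).
  move=> []; rewrite (_ : _ @^-1` _ = setT)//.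
  by apply/seteqP.
apply: le_trans (le_cond_entropyr mf mt mg _) _ => //.
rewrite /cond_entropy entropy_cst subr0.
rewrite (@eq_entropy _ _ _ _ _ _ (fun w => (f w, tt)) f)//.
by move=> x y; split=> [[]|->].
Qed.

Lemma cond_entropy_joint {U : choiceType} {J K : finType} (F : U -> Omega -> J)
    (s : seq U) (g : Omega -> K) :
  {in s, forall u, measurable_fibres (F u)} -> measurable_fibres g ->
  cond_entropy mu (joint F s) g <= \sum_(u <- s) cond_entropy mu (F u) g.
Proof.
elim: s => [|u s ih] mF mg.
  rewrite big_nil cond_entropy_coarser//.
  by move=> x y _; apply/joint_eqP.
have mFu : measurable_fibres (F u) by apply: mF; rewrite mem_head.
have mFs : {in s, forall v, measurable_fibres (F v)}.
  by move=> v vs; apply: mF; rewrite inE vs orbT.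
have mj := measurable_fibres_joint mFs.
rewrite big_cons; apply: le_trans (_ : _ <= cond_entropy mu (F u) g + _) _; last first.
  by rewrite lerD2l; exact: ih.
apply: le_trans (cond_entropy_pair_le mFu mj mg).
apply: le_cond_entropyl => //; first exact: measurable_fibres_joint.
  exact: measurable_fibres_pair.
move=> x y [e1 e2 _]; apply/joint_eqP => v; rewrite inE => /predU1P[->//|vs].
exact: (joint_coarser vs e2).
Qed.

Lemma measurable_fibres_coarser {I J : finType} (f : Omega -> I) (g : Omega -> J) :
  coarser f g -> measurable_fibres g -> measurable_fibres f.
Proof.
move=> fg mg i; rewrite (_ : _ @^-1` _ = g @^-1` (g @` (f @^-1` [set i]))).
  exact: measurable_fibres_pred.
by apply/seteqP; split=> [w fw|w [v /= <- /fg]//]; exists w.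
Qed.

(** From ln (1 / s) < 1 / s with s the square root of p, since
    ln p = 2 ln s. *)
Lemma neg_xlnx_le_sqrt (p : R) : 0 <= p -> neg_xlnx p <= 2 * Num.sqrt p.
Proof.
rewrite le_eqVlt => /predU1P[<-|p0].
  by rewrite /neg_xlnx mul0r oppr0 mulr_ge0 ?sqrtr_ge0.
have s0 : 0 < Num.sqrt p by rewrite sqrtr_gt0.
have pE : p = Num.sqrt p ^+ 2 by rewrite sqr_sqrtr// ltW.
rewrite /neg_xlnx {1 2}pE lnXn//; move: (Num.sqrt p) s0 => s s0.
have : ln s^-1 < s^-1 by rewrite ln_sublinear// invr_gt0.
rewrite lnV ?posrE// => /ltW/(ler_wpM2l (ltW (exprn_gt0 2 s0))).
have -> : s ^+ 2 * s^-1 = s by rewrite expr2 mulfK ?gt_eqF.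
by rewrite mulr2n; lra.
Qed.

Lemma neg_xlnx_1B_le (p : R) : 0 <= p -> neg_xlnx (1 - p) <= p.
Proof.
move=> p0; have [p1|p1] := ltP p 1; last first.
  by rewrite /neg_xlnx ln0 ?mulr0 ?oppr0// subr_le0.
have := @gibbs_term R (1 - p) 1; rewrite ln1 mulr0 add0r /neg_xlnx.
rewrite subr_ge0 (ltW p1) => /(_ isT ler01 (fun=> ltr01)); lra.
Qed.

Definition fano_bound (p : R) := 2 * Num.sqrt p + p.

(** Fano's inequality for a binary f guessed by c: knowing g, and hence c, the
    value of f is recovered from the error event, whose entropy is that of a
    coin of bias mu [f != c]. *)
Lemma fano {J : finType} (f c : Omega -> bool) (g : Omega -> J) :
  measurable_fibres f -> measurable_fibres g -> coarser c g ->
  cond_entropy mu f g <= fano_bound (fine (mu [set w | f w != c w])).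
Proof.
move=> mf mg cg; have mc := measurable_fibres_coarser cg mg.
pose e w := f w (+) c w.
have me : measurable_fibres e.
  move=> b; rewrite (_ : _ @^-1` _ = (fun w => (f w, c w)) @^-1`
    [set q : bool * bool | q.1 (+) q.2 = b])//.
  by apply: measurable_fibres_pred; exact: measurable_fibres_pair.
have eT : e @^-1` [set true] = [set w | f w != c w].
  by apply/seteqP; split=> w /=; rewrite /e; case: (f w); case: (c w).
apply: le_trans (_ : _ <= cond_entropy mu e g) _.
  apply: le_cond_entropyl => // x y [+ e2]; have := cg _ _ e2; rewrite /e => ->.
  by case: (f x) (f y) (c y) => [] [] [].
apply: le_trans (cond_entropy_le me mg) _.
rewrite /entropy big_bool/= /law eT; apply: lerD.
  by apply: neg_xlnx_le_sqrt; rewrite fine_ge0.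
have -> : e @^-1` [set false] = ~` [set w | f w != c w].
  by rewrite -eT; apply/seteqP; split=> w /=; case: (e w).
have meT : measurable [set w | f w != c w] by rewrite -eT; exact: me.
rewrite probability_setC// fineB ?fin_num_measure//=.
by apply: neg_xlnx_1B_le; rewrite fine_ge0.
Qed.

Lemma fano_bound_small (e : R) : 0 < e ->
  exists2 p, 0 < p & forall q, 0 <= q -> q <= p -> fano_bound q <= e.
Proof.
move=> e0; pose m := Num.min 1 (e / 3).
have m0 : 0 < m by rewrite lt_min ltr01/= divr_gt0.
have m1 : m <= 1 by rewrite ge_min lexx.
have me : m <= e / 3 by rewrite ge_min lexx orbT.
(* The square root of p costs a square: with p = m^2 the bound is at most 3 m. *)
exists (m ^+ 2); first by rewrite exprn_gt0.
move=> q q0 qm; rewrite /fano_bound.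
have : Num.sqrt q <= m by rewrite -(ger0_norm (ltW m0)) -sqrtr_sqr ler_wsqrtr.
have : m ^+ 2 <= m by rewrite expr2 ler_piMl // ltW.
lra.
Qed.

End conditional_entropy.

(** * Entropy rates *)
Section entropy_rates.
Context {d : measure_display} {Omega : measurableType d} {R : realType}.
Context (mu : probability Omega R) (T : Omega -> Omega).

Definition itinerary {I : Type} (f : Omega -> I) (n : nat) :=
  joint (fun k w => f (iter k T w)) (iota 0 n).

Lemma itinerary_eqP {I : Type} (f : Omega -> I) n x y :
  itinerary f n x = itinerary f n y <->
  forall k, (k < n)%N -> f (iter k T x) = f (iter k T y).
Proof.
split=> [/joint_eqP e k kn|e].
  by apply: e; rewrite mem_iota.
by apply/joint_eqP => k; rewrite mem_iota; exact: e.
Qed.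

Lemma itinerary_partition_blocks {I : Type} (f : Omega -> I) n :
  itinerary_partition T (blocks f) n = blocks (itinerary f n).
Proof.
apply/seteqP; split=> [B [+ [a [fa BE]]]|_ [x _ <-]].
  rewrite {}BE => -[x Bx]; exists x => //; apply/seteqP; split=> y /=.
    move=> /itinerary_eqP e k; have [z _ za] := fa k.
    by have /= := Bx k; rewrite -za/= (e _ (ltn_ord k)).
  move=> By; apply/itinerary_eqP => k kn.
  have [z _ za] := fa (Ordinal kn).
  by have := Bx (Ordinal kn); have := By (Ordinal kn); rewrite /= -za/= => -> ->.
split; first by exists x.
exists (fun k : 'I_n => f @^-1` [set f (iter k T x)]); split.
  by move=> k; exists (iter k T x).
apply/seteqP; split=> y /=.
  by move=> /itinerary_eqP e k; exact: e.
by move=> e; apply/itinerary_eqP => k kn; exact: (e (Ordinal kn)).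
Qed.

Lemma itineraryS {I : Type} (f : Omega -> I) n :
  same_kernel (itinerary f n.+1) (fun w => (f w, itinerary f n (T w))).
Proof.
move=> x y; split=> [/itinerary_eqP e|[e0 /itinerary_eqP e]].
  congr pair; first exact: (e 0%N).
  by apply/itinerary_eqP => k kn; rewrite -!iterSr; exact: e.
apply/itinerary_eqP => -[//|k] kn.
by rewrite !iterSr; exact: e.
Qed.

Context (hT : measure_preserving mu T).

Lemma measurable_fibres_comp {I : finType} (f : Omega -> I) :
  measurable_fibres f -> measurable_fibres (f \o T).
Proof.
by move=> mf i; rewrite comp_preimage -[_ @^-1` _]setTI; apply: hT.1.
Qed.

Lemma measurable_iter k : measurable_fun setT (iter k T).
Proof.
elim: k => [|k ih]; first exact: measurable_id.
exact: (measurableT_comp hT.1 ih).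
Qed.

Lemma measure_preserving_iter k (A : set Omega) : measurable A ->
  mu (iter k T @^-1` A) = mu A.
Proof.
elim: k A => [//|k ih] A mA.
rewrite -(hT.2 _ mA) -[RHS]ih//.
by rewrite -[_ @^-1` _]setTI; exact: hT.1.
Qed.

Lemma measurable_fibres_itinerary {I : finType} (f : Omega -> I) n :
  measurable_fibres f -> measurable_fibres (itinerary f n).
Proof.
move=> mf; apply: measurable_fibres_joint => k _ i.
rewrite [X in measurable X](_ : _ = iter k T @^-1` (f @^-1` [set i]))//.
by rewrite -[_ @^-1` _]setTI; exact: measurable_iter.
Qed.

Arguments measurable_fibres_itinerary {I f} n mf i.

Lemma entropy_comp {I : finType} (f : Omega -> I) :
  measurable_fibres f -> entropy mu (f \o T) = entropy mu f.
Proof.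
move=> mf; apply: eq_bigr => i _; congr neg_xlnx; congr fine.
exact: hT.2.
Qed.

Lemma cond_entropy_comp {I J : finType} (f : Omega -> I) (g : Omega -> J) :
  measurable_fibres f -> measurable_fibres g ->
  cond_entropy mu (f \o T) (g \o T) = cond_entropy mu f g.
Proof.
move=> mf mg; congr (_ - _); last exact: entropy_comp.
exact: (entropy_comp (measurable_fibres_pair mf mg)).
Qed.

(** The first step of the itinerary of f is split off and put last in the
    chain rule, so that it is conditioned on the whole future of f. *)
Lemma itinerary_cond_entropyS {I J : finType} (f : Omega -> I) (g : Omega -> J) n :
  measurable_fibres f -> measurable_fibres g ->
  cond_entropy mu (itinerary f n.+1) (itinerary g n.+1) <=
  cond_entropy mu f (fun w => (itinerary f n (T w), itinerary g n.+1 w)) +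
  cond_entropy mu (itinerary f n) (itinerary g n).
Proof.
move=> mf mg.
have mif k := measurable_fibres_itinerary k mf.
have mig k := measurable_fibres_itinerary k mg.
have mifT k := measurable_fibres_comp (mif k).
have migT k := measurable_fibres_comp (mig k).
have mp := measurable_fibres_pair mf (mifT n).
apply: (@le_trans _ _ (cond_entropy mu (fun w => (f w, itinerary f n (T w)))
                         (itinerary g n.+1))).
  apply: le_cond_entropyl => // x y [e1 e2 _].
  by apply/itineraryS; rewrite e1 e2.
rewrite cond_entropy_chain lerD2l -(cond_entropy_comp (mif n) (mig n)).
apply: le_cond_entropyr => //.
by move=> x y /itineraryS [].
Qed.

(** For the first n - m times the m following values of f are part of the
    itinerary; the last m times are estimated crudely by entropy f. *)
Lemma itinerary_cond_entropy_le {I J : finType} (f : Omega -> I) (g : Omega -> J)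
    m n :
  measurable_fibres f -> measurable_fibres g ->
  cond_entropy mu (itinerary f n) (itinerary g n) <=
  cond_entropy mu f (fun w => (g w, itinerary f m (T w))) *+ n +
  entropy mu f *+ minn n m.
Proof.
move=> mf mg.
have mif k := measurable_fibres_itinerary k mf.
have mig k := measurable_fibres_itinerary k mg.
have mifT k := measurable_fibres_comp (mif k).
have mgfT := measurable_fibres_pair mg (mifT m).
elim: n => [|n ih].
  rewrite min0n !mulr0n addr0 cond_entropy_coarser// => x y _.
  exact/itinerary_eqP.
apply: le_trans (itinerary_cond_entropyS n mf mg) _.
have mfg := measurable_fibres_pair (mifT n) (mig n.+1).
have [mn|] := boolP (m <= n)%N; last rewrite -ltnNge => nm.
  rewrite mulrS -[leRHS]addrA; apply: lerD; last first.
    by move: ih; rewrite (minn_idPr mn) (minn_idPr (leqW mn)).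
  apply: le_cond_entropyr => //.
  move=> x y [/itinerary_eqP e1 /itinerary_eqP e2]; congr pair.
    exact: (e2 0%N).
  by apply/itinerary_eqP => k km; apply: e1; exact: leq_trans mn.
move: ih; rewrite (minn_idPl nm) (minn_idPl (ltnW nm)) => ih.
rewrite [X in _ <= X + _]mulrS [X in _ <= _ + X]mulrS.
have := cond_entropy_le mu mf mfg; have := cond_entropy_ge0 mu mf mgfT.
move: ih; lra.
Qed.

Definition block_entropy {I : finType} (f : Omega -> I) n :=
  entropy mu (itinerary f n).

Lemma block_entropy0 {I : finType} (f : Omega -> I) : block_entropy f 0 = 0.
Proof.
rewrite -(entropy_cst mu); apply: eq_entropy => x y; split=> // _.
exact/itinerary_eqP.
Qed.

Lemma block_entropyS {I : finType} (f : Omega -> I) n : measurable_fibres f ->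
  block_entropy f n.+1 = cond_entropy mu f (itinerary f n \o T) + block_entropy f n.
Proof.
move=> mf; rewrite /block_entropy -(entropy_comp (measurable_fibres_itinerary n mf)).
by rewrite subrK; exact: (eq_entropy _ (itineraryS f n)).
Qed.

(** The increments of the block entropy are conditional entropies given longer
    and longer futures, hence nonincreasing, so that the last one is at most
    their average. *)
Lemma block_entropy_increment {I : finType} (f : Omega -> I) n :
  measurable_fibres f ->
  cond_entropy mu f (itinerary f n \o T) *+ n <= block_entropy f n.
Proof.
move=> mf; have mif k := measurable_fibres_itinerary k mf.
have mifT k := measurable_fibres_comp (mif k).
elim: n => [|n ih]; first by rewrite block_entropy0 mulr0n.
rewrite block_entropyS//.
have : cond_entropy mu f (itinerary f n.+1 \o T) <=
       cond_entropy mu f (itinerary f n \o T).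
  apply: le_cond_entropyr => // x y /itinerary_eqP e.
  by apply/itinerary_eqP => k kn; apply: e; rewrite ltnW.
move=> le; rewrite mulrS; apply: lerD => //.
by apply: le_trans ih; rewrite lerMn2r le orbT.
Qed.

Lemma block_entropy_ge0 {I : finType} (f : Omega -> I) n :
  measurable_fibres f -> 0 <= block_entropy f n.
Proof. by move=> mf; exact/entropy_ge0/measurable_fibres_itinerary. Qed.

(** Averages of a nonincreasing sequence of nonnegative increments are
    nonincreasing, so the limit that defines the entropy rate exists. *)
Lemma cvg_block_entropy {I : finType} (f : Omega -> I) : measurable_fibres f ->
  (fun n => n.+1%:R^-1 * block_entropy f n.+1) @ \oo -->
  entropy_rate mu T (blocks f).
Proof.
move=> mf; rewrite /entropy_rate.
set u := (X in limn X).
have uE : u = fun t => t%:R^-1 * block_entropy f t.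
  apply/funext => t.
  by rewrite /u itinerary_partition_blocks partition_entropy_blocks.
rewrite uE; clear u uE; set u := (X in limn X).
have cu : cvgn (fun n => u n.+1).
  apply: nonincreasing_is_cvgn.
    apply/nonincreasing_seqP => n.
    rewrite /u ler_pdivrMl// mulrCA ler_pdivlMl//.
    rewrite (block_entropyS n.+1)//.
    have := block_entropy_increment n.+1 mf; rewrite -mulr_natl.
    by rewrite mulrDr -(natr1 n.+1) mulrDl mul1r; lra.
  exists 0 => _ [n _ <-]; rewrite mulr_ge0 ?invr_ge0//.
  exact: block_entropy_ge0.
have : [sequence u n.+1]_n @ \oo --> limn (fun n => u n.+1) by exact: cu.
rewrite (_ : limn (fun n => u n.+1) = limn u)//.
by apply/esym/cvg_lim => //; rewrite -cvg_shiftS; exact: cu.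
Qed.

(** Past values of f cost nothing once the present value of f is nearly
    determined by g and the next m values of f; the boundary term
    m * entropy f disappears in the average. *)
Lemma entropy_rate_le {I J : finType} (f : Omega -> I) (g : Omega -> J) m :
  measurable_fibres f -> measurable_fibres g ->
  entropy_rate mu T (blocks f) <= entropy_rate mu T (blocks g) +
    cond_entropy mu f (fun w => (g w, itinerary f m (T w))).
Proof.
move=> mf mg; set c := cond_entropy _ _ _.
have mif k := measurable_fibres_itinerary k mf.
have mig k := measurable_fibres_itinerary k mg.
rewrite -[leRHS]addr0 -[X in _ <= _ + X](mulr0 (entropy mu f *+ m)).
apply: (@ler_cvg_to _ \oo _ _ (fun n => n.+1%:R^-1 * block_entropy f n.+1)
  (fun n => n.+1%:R^-1 * block_entropy g n.+1 + c + entropy mu f *+ m * harmonic n)).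
- exact: cvg_block_entropy.
- apply: cvgD; last by apply: cvgMr; exact: cvg_harmonic.
  by apply: cvgD; [exact: cvg_block_entropy|exact: cvg_cst].
near=> n.
rewrite /harmonic/= [_ *+ m * _]mulrC -[c](mulKf (_ : n.+1%:R != 0))//.
rewrite -!mulrDr ler_wpM2l ?invr_ge0//.
apply: (@le_trans _ _ (entropy mu (fun w => (itinerary f n.+1 w, itinerary g n.+1 w)))).
  by apply: le_entropy => //; [exact: measurable_fibres_pair|move=> x y []].
have := itinerary_cond_entropy_le m n.+1 mf mg.
rewrite {1}/cond_entropy -/(block_entropy g n.+1) -/c lerBlDr => /le_trans; apply.
rewrite addrC -addrA lerD2l mulr_natl lerD2l.
by rewrite ler_wpMn2l ?geq_minr ?entropy_ge0.
Unshelve. all: by end_near. Qed.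

End entropy_rates.
Arguments measurable_fibres_itinerary {d Omega R mu T} hT {I f} n mf i.

(** * Recurrence *)
Section recurrence.
Context {d : measure_display} {Omega : measurableType d} {R : realType}.
Context (mu : probability Omega R) (T : Omega -> Omega).
Context (hT : measure_preserving mu T).

Lemma small_tail (F : nat -> set Omega) e : (forall n, measurable (F n)) ->
  nonincreasing_seq F -> mu (\bigcap_n F n) = 0%E -> 0 < e ->
  exists n, forall m, (n <= m)%N -> fine (mu (F m)) <= e.
Proof.
move=> mF niF mu0 e0.
have : mu \o F @ \oo --> 0%:E.
  rewrite (_ : 0%:E = mu (\bigcap_n F n)); last by rewrite mu0.
  apply: nonincreasing_cvg_mu => //.
    by rewrite (le_lt_trans (probability_le1 _ _))// ltry.
  exact: bigcapT_measurable.
move=> /fine_cvg/cvgrPdist_le/(_ e e0) [n _ Hn]; exists n => m nm.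
by have := Hn m nm; rewrite /= sub0r normrN ger0_norm ?fine_ge0.
Qed.

(** The preimages of W under the iterates of T are disjoint and have equal
    measure, so infinitely many of them fit into a probability space only if
    W is null. *)
Lemma wandering_set_null (W : set Omega) : measurable W ->
  (forall w k, (0 < k)%N -> W w -> ~ W (iter k T w)) -> mu W = 0%E.
Proof.
move=> mW wW; pose F k := iter k T @^-1` W.
have mF k : measurable (F k).
  by rewrite -[F k]setTI; exact: (measurable_iter hT).
have tF : trivIset setT F.
  apply/trivIsetP => i j _ _ ij; apply/seteqP; split=> // w [].
  rewrite /F/=; wlog : i j ij / (i < j)%N => [wl|lt_ij].
    move: ij; rewrite neq_ltn => /orP[|] ij Wi Wj.
      by apply: (wl i j) => //; rewrite neq_ltn ij.
    by apply: (wl j i) => //; rewrite neq_ltn ij.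
  rewrite -(subnK (ltnW lt_ij)) iterD => Wi.
  by apply: wW Wi; rewrite subn_gt0.
have le1 n : fine (mu W) *+ n <= 1.
  rewrite -lee_fin EFin_natmul fineK ?fin_num_measure//.
  have <- : (\sum_(i < n) mu (F i) = mu W *+ n)%E.
    rewrite (eq_bigr (fun=> mu W)); last by move=> i _; exact: (measure_preserving_iter hT).
    by rewrite sumr_const card_ord.
  rewrite -(measure_bigsetU mu)//; apply: probability_le1.
  exact: bigsetU_measurable.
have [W0|W0] := ltP 0 (fine (mu W)); last first.
  rewrite -[LHS]fineK ?fin_num_measure//; congr (_%:E).
  by apply/eqP; rewrite eq_le W0 fine_ge0.
have /archi_boundP : 0 <= (fine (mu W))^-1 by rewrite invr_ge0 ltW.
rewrite -(ltr_pM2l W0) divff ?gt_eqF// mulr_natr => /lt_le_trans/(_ (le1 _)).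
by rewrite ltxx.
Qed.

Lemma measurable_holds (b : Omega -> bool) :
  measurable_fun setT b -> measurable [set w | b w].
Proof.
move=> mb; rewrite (_ : [set w | b w] = setT `&` b @^-1` [set true]).
  by apply: mb.
by rewrite setTI.
Qed.

Lemma measurable_comp_iter (Y : Omega -> R) r : measurable_fun setT Y ->
  measurable_fun setT (fun w => Y (iter r T w)).
Proof.
by move=> mY; apply: measurableT_comp => //; exact: (measurable_iter hT).
Qed.

(** Every return to this set N raises the value of Y.  If q is a rational
    number between the values of Y at w in N and at its first return, all
    returns of w lie above q, so w belongs to the wandering set W q of points
    of N that are at most q and only return above q. *)
Lemma strict_rise_null (Y : Omega -> R) a : measurable_fun setT Y ->
  mu [set w | a <= Y w /\ forall r, (0 < r)%N -> a <= Y (iter r T w) ->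
                Y w < Y (iter r T w)] = 0%E.
Proof.
move=> mY; set N := [set w | _].
have mYr r := measurable_comp_iter r mY.
have mN : measurable N.
  rewrite (_ : N = [set w | a <= Y w] `&` \bigcap_(r in [set r | (0 < r)%N])
     [set w | (a <= Y (iter r T w)) ==> (Y w < Y (iter r T w))]).
    apply: measurableI; first by apply: measurable_holds; exact: measurable_fun_ler.
    apply: bigcap_measurable => [|r r0]; first by exists 1%N.
    rewrite (_ : [set w | _] = ~` [set w | a <= Y (iter r T w)] `|`
      [set w | Y w < Y (iter r T w)]).
      apply: measurableU; last by apply: measurable_holds; exact: measurable_fun_ltr.
      by apply: measurableC; apply: measurable_holds; exact: measurable_fun_ler.
    apply/seteqP; split=> w /=.
      by move=> /implyP h; have [/h|] := boolP (a <= Y (iter r T w)); [right|left].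
    by move=> [h|->]; apply/implyP.
  apply/seteqP; split=> w /= [aY h]; split=> //.
    by move=> r r0 /=; apply/implyP; exact: h.
  by move=> r r0; apply/implyP; exact: (h r).
pose W (q : rat) := [set w | [/\ N w, Y w <= ratr q &
  forall r, (0 < r)%N -> N (iter r T w) -> ratr q < Y (iter r T w)]].
have mW q : measurable (W q).
  rewrite (_ : W q = N `&` [set w | Y w <= ratr q] `&`
    \bigcap_(r in [set r | (0 < r)%N])
      (~` (iter r T @^-1` N) `|` [set w | ratr q < Y (iter r T w)])).
    apply: measurableI.
      by apply: measurableI => //; apply: measurable_holds; exact: measurable_fun_ler.
    apply: bigcap_measurable => [|r r0]; first by exists 1%N.
    apply: measurableU; last by apply: measurable_holds; exact: measurable_fun_ltr.
    apply: measurableC; rewrite -[_ @^-1` _]setTI.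
    exact: (measurable_iter hT).
  apply/seteqP; split=> w /=.
    move=> [Nw qw h]; split=> // r r0.
    by have [Nr|Nr] := pselect (N (iter r T w)); [right; exact: h|left].
  by move=> [[Nw qw] h]; split=> // r r0 Nr; have [] := h r r0.
have W0 q : mu (W q) = 0%E.
  apply: wandering_set_null => // w k k0 [_ _ /(_ k k0) h] [/h qk + _].
  by rewrite leNgt qk.
have NW : N `<=` \bigcup_n W (odflt 0 (unpickle n)).
  move=> w Nw; suff [q Wq] : exists q, W q w.
    by exists (pickle q) => //; rewrite pickleK.
  have [ret|noret] := pselect (exists k, (0 < k)%N && `[< N (iter k T w) >]).
    case: (ex_minnP ret) => k /andP[k0' /asboolP Nk] mink.
    have [q] := rat_in_itvoo (Nw.2 k k0' Nk.1).
    rewrite in_itv/= => /andP[wq qk]; exists q; split=> //; first exact: ltW.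
    move=> r r0 Nr; have := mink r; rewrite r0/= => /(_ (asboolT Nr)).
    rewrite leq_eqVlt => /predU1P[<-//|kr]; apply: lt_trans qk _.
    have := Nk.2 (r - k)%N; rewrite subn_gt0 -iterD subnK ?(ltnW kr)//.
    by apply=> //; exact: Nr.1.
  (* Without any return the second condition in W q is vacuous. *)
  have /rat_in_itvoo[q] : Y w < Y w + 1 by rewrite ltrDl.
  rewrite in_itv/= => /andP[wq _]; exists q; split=> //; first exact: ltW.
  by move=> r r0 Nr; case: noret; exists r; rewrite r0; exact: asboolT.
apply: measure_negligible => //.
apply: negligibleS NW _; apply: negligible_bigcup => n.
by apply/negligibleP; [exact: mW|exact: W0].
Qed.

(** The test for a <= Y w that uses only comparisons of Y w with values in the
    near future and the outcomes of the same test event in the future. *)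
Definition recurs_above (Y : Omega -> R) a n (w : Omega) :=
  has (fun r => (a <= Y (iter r T w)) && (Y (iter r T w) <= Y w)) (iota 1 n).

Lemma recurs_aboveP (Y : Omega -> R) a n w : reflect
  (exists2 r, (0 < r <= n)%N & a <= Y (iter r T w) <= Y w) (recurs_above Y a n w).
Proof.
apply: (iffP hasP) => -[r]; rewrite ?mem_iota => rn h; exists r => //.
by rewrite mem_iota add1n ltnS.
Qed.

(** The test is never wrong when it succeeds, and the points on which it fails
    for every n form the null set of strict_rise_null. *)
Lemma recurs_above_approx (Y : Omega -> R) a e : measurable_fun setT Y -> 0 < e ->
  exists n, forall m, (n <= m)%N ->
    fine (mu [set w | (a <= Y w) != recurs_above Y a m w]) <= e.
Proof.
move=> mY e0; pose F n := [set w | (a <= Y w) != recurs_above Y a n w].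
have mYr r := measurable_comp_iter r mY.
have FE n : F n = [set w | a <= Y w] `&` \bigcap_(r in [set r | (0 < r <= n)%N])
     [set w | ~~ (a <= Y (iter r T w) <= Y w)].
  apply/seteqP; split=> w; rewrite /F/=.
    case: (leP a (Y w)) => [aY|aY] h.
      split=> // r rn; apply/negP => hr; move: h.
      by rewrite (introT (recurs_aboveP Y a n w) _)//; exists r.
    have /recurs_aboveP[r _ /andP[h1 h2]] : recurs_above Y a n w by case: recurs_above h.
    by have := le_trans h1 h2; rewrite leNgt aY.
  move=> [-> h]; case: (recurs_aboveP Y a n w) => // -[r rn hr].
  by move: (h r rn); rewrite /= hr.
have mF n : measurable (F n).
  rewrite FE; apply: measurableI; first by apply: measurable_holds; exact: measurable_fun_ler.
  have [->|n0] := eqVneq n 0%N.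
    rewrite (_ : [set r | _] = set0) ?bigcap_set0//.
    by apply/seteqP; split=> // r /=; case: r.
  apply: bigcap_measurable => [|r _]; first by exists 1%N; rewrite /= lt0n.
  apply: measurable_holds; apply: measurable_neg; apply: measurable_and; exact: measurable_fun_ler.
have niF : nonincreasing_seq F.
  move=> m n mn; apply/subsetPset; rewrite !FE; apply: setIS.
  by move=> w h r /= /andP[r0 rm]; apply: h; rewrite /= r0 (leq_trans rm).
have mu0 : mu (\bigcap_n F n) = 0%E.
  rewrite -(strict_rise_null a mY); congr (mu _); apply/seteqP; split=> w /=.
    move=> h; have := h 0%N I; rewrite FE => -[/= aY _]; split=> // r r0 ar.
    have := h r I; rewrite FE => -[_ /(_ r)] /=.
    by rewrite r0 leqnn ar/= -ltNge; exact.
  move=> [aY h] n _; rewrite FE; split=> // r /= /andP[r0 _].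
  by apply/negP => /andP[ar]; apply/negP; rewrite -ltNge; exact: h.
exact: small_tail.
Qed.

End recurrence.

(** * Ordinal partitions as fibres *)
Section partitions_as_blocks.
Context {O : Type}.

Lemma join_blocks {I J K : Type} (D : set I) (f : I -> O -> J) (g : O -> K) :
  (forall x y, g x = g y <-> forall i, D i -> f i x = f i y) ->
  join D (fun i => blocks (f i)) = blocks g.
Proof.
move=> gf; apply/seteqP; split=> [B [+ [a [fa BE]]]|_ [x _ <-]].
  rewrite {}BE => -[x Bx]; exists x => //; apply/seteqP; split=> y /=.
    move=> /gf e i Di; have [z _ za] := fa i Di.
    by have := Bx i Di; rewrite -za/= e.
  move=> By; apply/gf => i Di; have [z _ za] := fa i Di.
  by have := Bx i Di; have := By i Di; rewrite -za/= => -> ->.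
split; first by exists x.
exists (fun i => f i @^-1` [set f i x]); split; first by move=> i _; exists x.
by apply/seteqP; split=> y /=; [move=> /gf e i Di|move=> e; apply/gf => i Di];
  exact: e.
Qed.

Lemma set_partition_blocks {I : Type} (f : O -> I) : set_partition (blocks f).
Proof.
split.
- by apply/seteqP; split=> // x _; exists (f @^-1` [set f x]) => //; exists x.
- move=> _ _ [x _ <-] [y _ <-] [z [/= zx zy]].
  by rewrite -zx -zy.
- by move=> _ [x _ <-]; exists x.
Qed.

Lemma blocks_of_partition (s : seq (set O)) : set_partition [set` s] ->
  [set` s] = blocks (joint (fun (B : set O) w => w \in B) s).
Proof.
move=> ps; have fibre x B : B \in s -> B x ->
    B = joint (fun (B : set O) w => w \in B) s @^-1`
          [set joint (fun (B : set O) w => w \in B) s x].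
  move=> Bs Bx; apply/seteqP; split=> y /=.
    move=> By; apply/joint_eqP => C Cs; apply/idP/idP => /set_mem Cw; apply/mem_set.
      by rewrite (set_partition_eq ps Cs Bs Cw By).
    by rewrite (set_partition_eq ps Cs Bs Cw Bx).
  by move=> /joint_eqP/(_ B Bs) e; apply/set_mem; rewrite e; exact/mem_set.
apply/seteqP; split=> [B Bs|_ [x _ <-]].
  have [_ _ /(_ B Bs)[x Bx]] := ps; exists x => //.
  by rewrite -(fibre x B).
have [B Bs Bx] := set_partition_cover x ps.
by rewrite /= -(fibre x B Bs Bx).
Qed.

End partitions_as_blocks.

Lemma finite_measurable_partition_blocks {d : measure_display}
    {Omega : measurableType d} {I : finType} (f : Omega -> I) :
  measurable_fibres f -> finite_measurable_partition (blocks f).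
Proof.
move=> mf; split; last exact: set_partition_blocks.
  rewrite (_ : blocks f = (fun i => f @^-1` [set i]) @` (range f)); last first.
    by rewrite image_comp.
  by apply: finite_image; exact: finite_finset.
by move=> _ [x _ <-]; exact: mf.
Qed.

Section ordinal_patterns.
Context {d : measure_display} {Omega : measurableType d} {R : realType}.
Context (T : Omega -> Omega) (X : nat -> Omega -> R).

Definition comparison (q : nat * (nat * nat)) (w : Omega) : bool :=
  X q.1 (iter q.2.1 T w) < X q.1 (iter q.2.2 T w).

Definition comparisons (dd n : nat) : seq (nat * (nat * nat)) :=
  [seq q <- [seq (i, st) | i <- iota 0 n,
              st <- [seq (s, t) | s <- iota 0 dd.+1, t <- iota 0 dd.+1]]
  | (q.2.1 < q.2.2)%N].

Lemma mem_comparisons dd n i s t :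
  ((i, (s, t)) \in comparisons dd n) = (i < n)%N && (s < t <= dd)%N.
Proof.
rewrite mem_filter; apply/andP/andP.
  move=> [st /allpairsP[p [iN /allpairsP[p' [_ tN pE]] [ip stp]]]].
  move: st iN tN; rewrite -ip; move: pE; rewrite -stp => -[-> ->].
  by rewrite !mem_iota !add0n /= ltnS => -> -> ->.
move=> [iN /andP[st tdd]]; split=> //; apply: allpairs_f; first by rewrite mem_iota.
by apply: allpairs_f; rewrite mem_iota/= add0n ltnS// (leq_trans _ tdd)// ltnW.
Qed.

Definition ordinal_pattern dd n := joint comparison (comparisons dd n).

Lemma ordinal_partition_blocks dd n :
  ordinal_partition T X dd n = blocks (ordinal_pattern dd n).
Proof.
pose c i (st : nat * nat) := comparison (i, st).
have c2 i st : ordinal_partition2 T (X i) st.1 st.2 = blocks (c i st).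
  apply/seteqP; split=> [B [[x Bx] [BE|BE]]|_ [x _ <-]].
  - exists x => //; move: Bx; rewrite BE /= => Bx.
    by apply/seteqP; split=> y /=; rewrite /c/comparison Bx.
  - exists x => //; move: Bx; rewrite BE /= => Bx.
    apply/seteqP; split=> y; rewrite /c/comparison/= !ltNge Bx/=; first by move/negbFE.
    by move=> ->.
  - split; first by exists x.
    have [cx|cx] := boolP (c i st x); [left|right].
      by apply/seteqP; split=> y /=.
    apply/seteqP; split=> y /=; rewrite leNgt; first by move=> cy; rewrite [_ < _]cy.
    by move/negbTE.
pose cs i w := fun st => (st.1 < st.2 <= dd)%N && c i st w.
have cE i : join [set st : nat * nat | (st.1 < st.2 <= dd)%N]
    (fun st => ordinal_partition2 T (X i) st.1 st.2) = blocks (cs i).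
  rewrite (_ : (fun st => _) = fun st => blocks (c i st)); last exact/funext.
  apply: join_blocks => x y; split=> [e st stdd|e].
    by have := congr1 (@^~ st) e; rewrite /cs stdd.
  apply/funext => st; rewrite /cs; have [stdd|//] := boolP (st.1 < st.2 <= dd)%N.
  by rewrite (e st).
rewrite /ordinal_partition (funext cE).
apply: join_blocks => x y; split=> [/joint_eqP e i iN|e].
  apply/funext => -[s t]; rewrite /cs/=; have [stdd|//] := boolP (s < t <= dd)%N.
  by apply: (e (i, (s, t))); rewrite mem_comparisons iN.
apply/joint_eqP => -[i [s t]]; rewrite mem_comparisons => /andP[iN stdd].
by have := congr1 (@^~ (s, t)) (e i iN); rewrite /cs/= stdd.
Qed.

Lemma ordinal_pattern_coarser dd n dd' n' : (dd <= dd')%N -> (n <= n')%N ->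
  coarser (ordinal_pattern dd n) (ordinal_pattern dd' n').
Proof.
move=> ddd nn; apply: sub_joint => -[i [s t]]; rewrite !mem_comparisons.
by move=> /andP[/leq_trans-> //= /andP[-> /leq_trans->]].
Qed.

End ordinal_patterns.

(** * Approximation by a generating family of events *)
Section approximation.
Context {d : measure_display} {Omega : measurableType d} {R : realType}.
Context (mu : probability Omega R).
Context {V : choiceType} (b : V -> Omega -> bool).
Context (mb : forall v, measurable_fibres (b v)).

Definition indicator (B : set Omega) (w : Omega) : bool := w \in B.

Lemma measurable_fibres_indicator B :
  measurable B -> measurable_fibres (indicator B).
Proof.
move=> mB []; [rewrite (_ : _ @^-1` _ = B)// |
               rewrite (_ : _ @^-1` _ = ~` B); last 1 first].
- by apply/seteqP; split=> w /=; [move/set_mem|move/mem_set].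
- apply/seteqP; split=> w /=; rewrite /indicator.
    by move=> wB /mem_set; rewrite wB.
  by move=> nB; apply/negbTE/negP => /set_mem.
- exact: measurableC.
Qed.

Lemma measurable_fibres_joint_all (s : seq V) : measurable_fibres (joint b s).
Proof. by apply: measurable_fibres_joint => v _. Qed.

Arguments measurable_fibres_joint_all s i : clear implicits.

Definition entropy_approximable {I : finType} (f : Omega -> I) :=
  forall e, 0 < e -> exists s, cond_entropy mu f (joint b s) <= e.

(** Conditional entropy is subadditive in the first argument and decreases in
    the second, so the approximations of the single members can be pooled. *)
Lemma entropy_approximable_joint {U : choiceType} (F : U -> Omega -> bool) s :
  {in s, forall u, measurable_fibres (F u)} ->
  {in s, forall u, entropy_approximable (F u)} ->
  entropy_approximable (joint F s).
Proof.
move=> mF aF e e0.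
suff [s' s'e] : exists s', \sum_(u <- s) cond_entropy mu (F u) (joint b s') <= e.
  exists s'; apply: le_trans s'e; apply: cond_entropy_joint => //.
  exact: measurable_fibres_joint_all.
elim: s mF aF e e0 => [|u s ih] mF aF e e0.
  by exists [::]; rewrite big_nil ltW.
have e2 : 0 < e / 2 by rewrite divr_gt0.
have [s1 s1e] : exists s', \sum_(u <- s) cond_entropy mu (F u) (joint b s') <= e / 2.
  by apply: ih => // v vs; [apply: mF|apply: aF]; rewrite inE vs orbT.
have [s2 s2e] := aF u (mem_head _ _) _ e2.
exists (s1 ++ s2); rewrite big_cons.
have mono v s' : v \in u :: s -> {subset s' <= s1 ++ s2} ->
    cond_entropy mu (F v) (joint b (s1 ++ s2)) <= cond_entropy mu (F v) (joint b s').
  move=> vs ss; apply: le_cond_entropyr; try exact: measurable_fibres_joint_all.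
    exact: mF.
  exact: sub_joint.
rewrite [e in _ <= e]splitr addrC; apply: lerD.
  apply: le_trans s1e; rewrite big_seq [leRHS]big_seq; apply: ler_sum => v vs.
  by apply: mono => [|x xs]; rewrite ?inE ?vs ?orbT// mem_cat xs.
apply: le_trans s2e; apply: mono; first exact: mem_head.
by move=> x xs; rewrite mem_cat xs orbT.
Qed.

Lemma entropy_approximable_modulo_null (A B : set Omega) :
  measurable A -> measurable B -> mu (A `+` B) = 0%E ->
  entropy_approximable (indicator A) -> entropy_approximable (indicator B).
Proof.
move=> mA mB AB0 aA e e0; have [s se] := aA e e0; exists s.
have mjs := measurable_fibres_joint_all s.
have mIA := measurable_fibres_indicator mA.
have mIB := measurable_fibres_indicator mB.
apply: le_trans (cond_entropy_trans mu mIB mIA mjs) _.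
suff : cond_entropy mu (indicator B) (indicator A) <= 0 by lra.
apply: le_trans (fano mu mIB mIA (_ : coarser (indicator A) _)) _ => //.
rewrite (_ : [set w | _] = A `+` B) ?AB0 /fano_bound/= ?sqrtr0 ?mulr0 ?addr0//.
rewrite /indicator; apply/seteqP; split=> w /=; last first.
  by move=> [[wA wB]|[wB wA]]; [rewrite (mem_set wA) (memNset wB)|rewrite (memNset wA) (mem_set wB)].
have [wA|wA] := pselect (A w); have [wB|wB] := pselect (B w).
- by rewrite !mem_set.
- by left.
- by right.
- by rewrite !memNset.
Qed.

(** For a countable union, the indicator is almost determined by those of
    finitely many of the sets, by Fano's inequality and continuity of mu, and
    the latter are jointly approximable. *)
Lemma entropy_approximable_sigma_algebra :
  sigma_algebra setT
    [set B | measurable B /\ entropy_approximable (indicator B)].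
Proof.
split=> /=.
- split=> // e e0; exists [::]; rewrite cond_entropy_coarser ?ltW//.
- move=> B [mB aB]; rewrite setTD; split; first exact: measurableC.
  move=> e /aB[s se]; exists s; apply: le_trans se.
  apply: le_cond_entropyl; try exact: measurable_fibres_joint_all.
  + exact/measurable_fibres_indicator/measurableC.
  + exact: measurable_fibres_indicator.
  by move=> x y [+ _]; rewrite /indicator !in_setC => ->.
- move=> B aB; have mB k := (aB k).1; split; first exact: bigcup_measurable.
  set U := \bigcup_k B k; have mU : measurable U by exact: bigcup_measurable.
  have mIU := measurable_fibres_indicator mU.
  have mIB k := measurable_fibres_indicator (mB k).
  move=> e e0; have e2 : 0 < e / 2 by rewrite divr_gt0.
  pose c n w := has (fun k => w \in B k) (iota 0 n).
  pose F n := [set w | indicator U w != c n w].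
  pose G n := joint (fun k => indicator (B k)) (iota 0 n).
  have mG n : measurable_fibres (G n) by apply: measurable_fibres_joint => k _.
  have cG n : coarser (c n) (G n).
    move=> x y /joint_eqP e'; apply: eq_in_has => k kn; exact: e'.
  have FE n : F n = U `\` \bigcup_(k in [set k | (k < n)%N]) B k.
    rewrite /F/indicator; apply/seteqP; split=> w /=.
      have cU : c n w -> w \in U.
        by move=> /hasP[k _ /set_mem Bk]; apply/mem_set; exists k.
      case: (boolP (w \in U)) cU => [/set_mem Uw _ h|_ cU].
        split=> // -[k kn Bk]; move/negP: h; apply; rewrite eq_sym eqb_id.
        by apply/hasP; exists k; [rewrite mem_iota|exact/mem_set].
      by case: (c n w) cU => // /(_ isT).
    move=> [/mem_set -> h]; rewrite eq_sym eqb_id; apply/negP => /hasP[k].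
    by rewrite mem_iota => kn /set_mem Bk; apply: h; exists k.
  have mF n : measurable (F n).
    by rewrite FE; apply: measurableD => //; exact: bigcup_measurable.
  have niF : nonincreasing_seq F.
    move=> m n mn; apply/subsetPset; rewrite !FE => w [Uw h]; split=> // -[k km Bk].
    by apply: h; exists k => //=; exact: leq_trans mn.
  have F0 : mu (\bigcap_n F n) = 0%E.
    rewrite (_ : \bigcap_n F n = set0) ?measure0//.
    apply/seteqP; split=> // w h.
    have := h 0%N I; rewrite FE => -[[k _ Bk] _].
    by have := h k.+1 I; rewrite FE => -[_]; apply; exists k => /=.
  have [p p0 pe] := fano_bound_small e2.
  have [n /(_ n (leqnn n)) nF] := small_tail mF niF F0 p0.
  have [s se] : exists s, cond_entropy mu (G n) (joint b s) <= e / 2.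
    apply: (entropy_approximable_joint (F := fun k => indicator (B k))) => //.
      by move=> k _; exact: (aB k).2.
  exists s; have mjs := measurable_fibres_joint_all s.
  apply: le_trans (cond_entropy_trans mu mIU (mG n) mjs) _.
  rewrite [e in _ <= e]splitr; apply: lerD => //.
  apply: le_trans (fano mu mIU (mG n) (cG n)) _.
  by apply: pe => //; rewrite fine_ge0.
Qed.

End approximation.
Arguments measurable_fibres_joint_all {d Omega V b} mb s i.

(** * Entropy rates of ordinal partitions *)
Section ordinal_patterns_suffice.
Context {d : measure_display} {Omega : measurableType d} {R : realType}.
Context (mu : probability Omega R) (T : Omega -> Omega).
Context (X : nat -> Omega -> R).
Context (hT : measure_preserving mu T).
Context (mX : forall i, measurable_fun setT (X i)).

Definition threshold (u : nat * (nat * R)) (w : Omega) : bool :=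
  u.2.2 <= X u.1 (iter u.2.1 T w).

Lemma measurable_observable i t : measurable_fun setT (X i \o iter t T).
Proof. exact: (measurable_comp_iter hT t (mX i)). Qed.

Lemma measurable_fibres_bool (b : Omega -> bool) :
  measurable_fun setT b -> measurable_fibres b.
Proof. by move=> mb i; rewrite -[_ @^-1` _]setTI; exact: mb. Qed.

Lemma measurable_fibres_threshold u : measurable_fibres (threshold u).
Proof.
apply: measurable_fibres_bool; apply: measurable_fun_ler => //.
exact: measurable_observable.
Qed.

Lemma measurable_fibres_ordinal_pattern dd n :
  measurable_fibres (ordinal_pattern T X dd n).
Proof.
apply: measurable_fibres_joint => q _; apply: measurable_fibres_bool.
by apply: measurable_fun_ltr; exact: measurable_observable.
Qed.
Arguments measurable_fibres_ordinal_pattern dd n i : clear implicits.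

Lemma sigma_orbit_approximable B : sigma_orbit T X B ->
  measurable B /\ entropy_approximable mu threshold (indicator B).
Proof.
pose D := [set B | measurable B /\ entropy_approximable mu threshold (indicator B)].
have sD : sigma_algebra setT D.
  exact: entropy_approximable_sigma_algebra measurable_fibres_threshold.
apply: (smallest_sub (X := D)) => // _ [i _ [t _ [A mA <-]]]; rewrite setTI.
have [D0 DC DU] := sD.
suff : (@RGenCInfty.G R).-sigma.-measurable `<=`
    [set A | D ((X i \o iter t T) @^-1` A)].
  by apply; rewrite -RGenCInfty.measurableE.
move=> {A mA}; apply: smallest_sub.
  split=> /=; first by rewrite preimage_set0.
    by move=> A DA; exact: (DC _ DA).
  by move=> A DA; rewrite preimage_bigcup; exact: DU.
move=> _ [x ->] /=; set B' := _ @^-1` _.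
have mB' : measurable B'.
  by rewrite /B' -[_ @^-1` _]setTI; exact: (measurable_observable i t).
split=> // e e0; exists [:: (i, (t, x))]; rewrite cond_entropy_coarser ?ltW//.
have tE w : indicator B' w = threshold (i, (t, x)) w.
  apply/idP/idP => [/set_mem|h]; last apply/mem_set; rewrite /B' /= in_itv/= andbT//.
by move=> y z yz; rewrite !tE (joint_coarser (mem_head _ _) yz).
Qed.

Lemma threshold_cond_entropy_small u e : 0 < e ->
  exists D, forall m, (D <= m)%N -> forall (K : finType) (g : Omega -> K),
    measurable_fibres g ->
    coarser (recurs_above T (X u.1 \o iter u.2.1 T) u.2.2 m) g ->
    cond_entropy mu (threshold u) g <= e.
Proof.
move=> e0; have [p p0 pe] := fano_bound_small e0.
have [D HD] := recurs_above_approx hT u.2.2 (measurable_observable u.1 u.2.1) p0.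
exists D => m Dm K g mg cg.
apply: le_trans (fano mu (@measurable_fibres_threshold u) mg cg) _.
by apply: pe; [rewrite fine_ge0|exact: HD].
Qed.

Lemma thresholds_cond_entropy_small (s : seq (nat * (nat * R))) e : 0 < e ->
  exists D, forall m, (D <= m)%N -> forall (K : finType) (g : Omega -> K),
    measurable_fibres g ->
    {in s, forall u, coarser (recurs_above T (X u.1 \o iter u.2.1 T) u.2.2 m) g} ->
    cond_entropy mu (joint threshold s) g <= e.
Proof.
move=> e0; suff [D HD] : exists D, forall m, (D <= m)%N ->
    forall (K : finType) (g : Omega -> K), measurable_fibres g ->
    {in s, forall u, coarser (recurs_above T (X u.1 \o iter u.2.1 T) u.2.2 m) g} ->
    \sum_(u <- s) cond_entropy mu (threshold u) g <= e.
  exists D => m Dm K g mg cg; apply: le_trans (HD m Dm K g mg cg).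
  apply: cond_entropy_joint => // u _; exact: measurable_fibres_threshold.
elim: s e e0 => [|u s ih] e e0.
  by exists 0%N => *; rewrite big_nil ltW.
have e2 : 0 < e / 2 by rewrite divr_gt0.
have [D1 H1] := threshold_cond_entropy_small u e2; have [D2 H2] := ih _ e2.
exists (maxn D1 D2) => m; rewrite geq_max => /andP[D1m D2m] K g mg cg.
rewrite big_cons [e in _ <= e]splitr; apply: lerD.
  by apply: (H1 m) => //; exact/cg/mem_head.
by apply: (H2 m) => // v vs; apply: cg; rewrite inE vs orbT.
Qed.

(** The test needs, at each r in 1..m, the comparison of times t and t + r and
    the outcome of the threshold (i, (t, a)) at time r, which is the value at
    time r - 1 of the itinerary started at T w. *)
Lemma recurs_above_coarser (s : seq (nat * (nat * R))) m dd n i t a :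
  (i, (t, a)) \in s -> (i < n)%N -> (t + m <= dd)%N ->
  coarser (recurs_above T (X i \o iter t T) a m)
    (fun w => (ordinal_pattern T X dd n w, itinerary T (joint threshold s) m (T w))).
Proof.
move=> us iN tdd x y [/joint_eqP eo /itinerary_eqP ei].
apply: eq_in_has => r; rewrite mem_iota add1n ltnS => /andP[r0 rm].
congr (_ && _).
  have r1 : (r.-1 < m)%N by rewrite prednK.
  have := joint_coarser us (ei _ r1).
  by rewrite -!iterSr prednK.
have /= := eo (i, (t, t + r)%N); rewrite /comparison /= !iterD => e.
rewrite !leNgt e// mem_comparisons iN.
by rewrite -[X in (X < _)%N]addn0 ltn_add2l r0/= (leq_trans _ tdd)// leq_add2l.
Qed.

(** The partition C is replaced by finitely many thresholds A, and A by an
    ordinal partition long enough to run the recurrence test on each of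
    them; each replacement costs e / 2. *)
Lemma ordinal_rate_approximates (C : set (set Omega)) e :
  mu_supset mu (sigma_orbit T X) measurable ->
  finite_measurable_partition C -> 0 < e ->
  exists dd n, entropy_rate mu T C <=
    entropy_rate mu T (ordinal_partition T X dd n) + e.
Proof.
move=> hX [/finite_seqP[c ->] mc pc] e0.
rewrite (blocks_of_partition pc).
rewrite -[X in blocks X]/(joint indicator c).
have mI : {in c, forall B, measurable_fibres (indicator B)}.
  by move=> B Bc; apply: measurable_fibres_indicator; exact: mc.
have mJ := measurable_fibres_joint mI.
have aC : entropy_approximable mu threshold (joint indicator c).
  apply: entropy_approximable_joint => //; first exact: measurable_fibres_threshold.
  move=> B /mc mB; have [A /sigma_orbit_approximable[mA aA] AB] := hX B mB.
  exact: (entropy_approximable_modulo_null measurable_fibres_threshold mA mB AB aA).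
have e2 : 0 < e / 2 by rewrite divr_gt0.
have [s se] := aC _ e2.
have mS := measurable_fibres_joint_all measurable_fibres_threshold s.
have [D /(_ D (leqnn D)) HD] := thresholds_cond_entropy_small s e2.
pose dd := (\max_(u <- s) u.2.1 + D)%N; pose n := (\max_(u <- s) u.1).+1.
exists dd, n; rewrite ordinal_partition_blocks.
have mO := measurable_fibres_ordinal_pattern dd n.
have mSD := measurable_fibres_comp hT (measurable_fibres_itinerary hT D mS).
apply: le_trans (entropy_rate_le hT 0 mJ mS) _.
apply: le_trans (_ : _ <= entropy_rate mu T (blocks (ordinal_pattern T X dd n)) +
  e / 2 + e / 2) _; last by rewrite -addrA -splitr.
apply: lerD.
  apply: le_trans (entropy_rate_le hT D mS mO) _; rewrite lerD2l.
  apply: HD; first exact: measurable_fibres_pair.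
  move=> [i [t a]] us; apply: recurs_above_coarser => //=.
    by rewrite /n ltnS; exact: (leq_bigmax_seq (F := fun u : nat * (nat * R) => u.1) (i, (t, a)) us isT).
  rewrite /dd leq_add2r.
  exact: (leq_bigmax_seq (F := fun u : nat * (nat * R) => u.2.1) (i, (t, a)) us isT).
apply: le_trans se; apply: le_cond_entropyr => //.
  apply: measurable_fibres_pair => //.
  exact: (measurable_fibres_comp hT (measurable_fibres_itinerary hT 0 mJ)).
by move=> x y [].
Qed.

Lemma ordinal_rate_mono dd n dd' n' : (dd <= dd')%N -> (n <= n')%N ->
  entropy_rate mu T (ordinal_partition T X dd n) <=
  entropy_rate mu T (ordinal_partition T X dd' n').
Proof.
move=> ddd nn; rewrite !ordinal_partition_blocks.
have mO := measurable_fibres_ordinal_pattern dd n.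
have mO' := measurable_fibres_ordinal_pattern dd' n'.
apply: le_trans (entropy_rate_le hT 0 mO mO') _.
rewrite cond_entropy_coarser ?addr0// => x y [e _].
exact: ordinal_pattern_coarser e.
Qed.

Lemma ordinal_rate_le_KS dd n :
  ((entropy_rate mu T (ordinal_partition T X dd n))%:E <= KS_entropy mu T)%E.
Proof.
apply: ereal_sup_ubound; exists (ordinal_partition T X dd n) => //.
rewrite ordinal_partition_blocks; apply: finite_measurable_partition_blocks.
exact: measurable_fibres_ordinal_pattern.
Qed.

End ordinal_patterns_suffice.

Lemma cvg_monotone_ereal_sup {R : realType} (h : nat * nat -> R) (S : \bar R) :
  (forall m n m' n', (m <= m')%N -> (n <= n')%N -> h (m, n) <= h (m', n')) ->
  (forall q, ((h q)%:E <= S)%E) ->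
  (forall y, (y%:E < S)%E -> exists q, y < h q) ->
  (fun q => (h q)%:E) @ filter_prod \oo \oo --> S.
Proof.
move=> hmono hS Sh.
have ev y : (y%:E < S)%E -> \forall q \near filter_prod \oo \oo, y < h q.
  move=> /Sh[[m n] ymn]; exists ([set k | (m <= k)%N], [set k | (n <= k)%N]).
    by split; [exists m|exists n].
  by move=> [m' n'] [/= mm nn]; apply: lt_le_trans ymn _; exact: hmono.
case: S hS Sh ev => [r| |] hS Sh ev.
- apply: cvg_EFin; first by near=> q.
  apply/cvgrPdist_le => e e0.
  have /ev : ((r - e)%:E < r%:E)%E by rewrite lte_fin ltrBlDr ltrDl.
  apply: filterS => q req; have := hS q; rewrite lee_fin => hqr.
  by rewrite /= ger0_norm; lra.
- apply/cvgeyPge => y; have := ev y (ltry y); apply: filterS => q /ltW.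
  by rewrite lee_fin.
- by have := hS (0%N, 0%N); rewrite leNgt ltNyr.
Unshelve. all: by end_near. Qed.

Theorem theorem1p1 (d : measure_display) (Omega : measurableType d)
    (R : realType) (mu : probability Omega R) (T : Omega -> Omega)
    (X : nat -> {RV mu >-> R}) :
  measure_preserving mu T ->
  mu_supset mu (sigma_orbit T X) measurable ->
  ergodic mu T \/ borel_in_compact_metrizable Omega R ->
  (fun dn : nat * nat =>
     (entropy_rate mu T (ordinal_partition T X dn.1 dn.2))%:E)
    @ filter_prod \oo \oo --> KS_entropy mu T /\
  KS_entropy mu T =
    ereal_sup [set (entropy_rate mu T (ordinal_partition T X dn.1 dn.2))%:E
              | dn in [set dn : nat * nat | (0 < dn.1)%N /\ (0 < dn.2)%N]].
Proof.
move=> hT hX _.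
have mX i : measurable_fun setT (X i) by exact: measurable_funPT.
split.
  apply: (cvg_monotone_ereal_sup
    (h := fun q => entropy_rate mu T (ordinal_partition T X q.1 q.2))).
  - by move=> m n m' n'; exact: ordinal_rate_mono.
  - by move=> q; exact: ordinal_rate_le_KS.
  move=> y /ereal_sup_gt[_ [C mC <-]]; rewrite lte_fin -subr_gt0 => yC.
  have e0 : 0 < (entropy_rate mu T C - y) / 2 by rewrite divr_gt0.
  have [dd [n]] := ordinal_rate_approximates hT mX hX mC e0.
  by exists (dd, n) => /=; lra.
apply/eqP; rewrite eq_le; apply/andP; split.
  apply: ge_ereal_sup => _ [C mC <-]; apply/lee_addgt0Pr => e e0.
  have [dd [n Cdn]] := ordinal_rate_approximates hT mX hX mC e0.
  apply: (@le_trans _ _ (entropy_rate mu T (ordinal_partition T X dd.+1 n.+1) + e)%:E).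
    rewrite lee_fin; apply: le_trans Cdn _; rewrite lerD2r.
    exact: ordinal_rate_mono.
  rewrite EFinD leeD2r//; apply: ereal_sup_ubound.
  by exists (dd.+1, n.+1).
by apply: ge_ereal_sup => _ [q _ <-]; exact: ordinal_rate_le_KS.
Qed.
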